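(* Let $t,r$ be integers with $\min\{t,r\}\ge 2$, and let $P_m$ denote the path on $m$ vertices. Then $$\chi_\mu(P_t\boxtimes P_r)=\begin{cases}1 & \text{if } t=r=2,\\ 2 & \text{if } t\ne r \text{ and } \min\{t,r\}=2,\\ \min\{\lceil t/2\rceil,\lceil r/2\rceil\} & \text{otherwise.}\end{cases}$$
   Context: All graphs are finite and simple. The strong product $G\boxtimes H$ has vertex set $V(G)\times V(H)$, with distinct $(g,h),(g',h')$ adjacent iff ($g=g'$ or $gg'\in E(G)$) and ($h=h'$ or $hh'\in E(H)$). A geodesic is a shortest path. For $X\subseteq V$, two vertices $x,y\in X$ are $X$-visible if some $x,y$-geodesic has no internal vertex in $X$; $X$ is a mutual-visibility (MV) set if every two of its vertices are $X$-visible. $\chi_\mu$ is the least $k$ such that the vertex set can be partitioned into $k$ MV sets. *)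

(* Defs.v *)
From mathcomp Require Import all_boot.
From mathcomp Require Import boolp.

Set Implicit Arguments.
Unset Strict Implicit.
Unset Printing Implicit Defensive.

Record sgraph := SGraph {
  vertex :> finType;
  adj : rel vertex;
  adj_sym : symmetric adj;
  adj_irr : irreflexive adj }.

Section MutualVisibility.
Variable G : sgraph.
Implicit Types (x y : G) (p q : seq G) (X : {set G}).

(* As in mathcomp's path.v, the sequence p lists the vertices after x. *)
Definition is_path x y p : Prop :=
  [/\ path (@adj G) x p, last x p = y & uniq (x :: p)].

Definition geodesic x y p : Prop :=
  is_path x y p /\ forall q, is_path x y q -> size p <= size q.

(* The vertices of x :: p other than its two ends. *)
Definition internal x p : seq G := behead (belast x p).

Definition visible X x y : Prop :=
  exists2 p, geodesic x y p & forall z, z \in internal x p -> z \notin X.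

Definition mv_set X : Prop :=
  forall x y, x \in X -> y \in X -> x != y -> visible X x y.

Definition mv_partition (P : {set {set G}}) : Prop :=
  partition P [set: G] /\ forall X, X \in P -> mv_set X.

Definition mv_partitionable (k : nat) : Prop :=
  exists2 P : {set {set G}}, mv_partition P & #|P| = k.

(* The partition into singletons always qualifies, so the minimum exists. *)
Lemma mv_partitionable_ex : exists k, `[< mv_partitionable k >].
Proof.
pose P := [set [set x] | x in [set: G]].
exists #|P|; apply/asboolP; exists P => //; split.
  apply/and3P; split.
  - rewrite /cover; apply/eqP/setP => x; rewrite inE; apply/bigcupP.
    by exists [set x]; rewrite ?set11 ?imset_f ?inE.
  - apply/trivIsetP => A B /imsetP[x _ ->] /imsetP[y _ ->] nAB.
    by rewrite disjoints1 inE; apply: contraNneq nAB => ->.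
  - by apply/imsetP => -[x _ /setP/(_ x)]; rewrite set11 inE.
by move=> X /imsetP[z _ ->] x y /set1P-> /set1P->; rewrite eqxx.
Qed.

Definition chi_mu : nat := ex_minn mv_partitionable_ex.

End MutualVisibility.

Section StrongProduct.
Variables G H : sgraph.

Definition strong_adj : rel (G * H) := fun u v =>
  [&& u != v, (u.1 == v.1) || adj u.1 v.1 & (u.2 == v.2) || adj u.2 v.2].

Lemma strong_adj_sym : symmetric strong_adj.
Proof.
move=> u v; rewrite /strong_adj eq_sym (eq_sym u.1) (eq_sym u.2).
by rewrite (@adj_sym G u.1) (@adj_sym H u.2).
Qed.

Lemma strong_adj_irr : irreflexive strong_adj.
Proof. by move=> u; rewrite /strong_adj eqxx. Qed.

Definition strong_prod : sgraph := SGraph strong_adj_sym strong_adj_irr.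

End StrongProduct.

Notation "G ⊠ H" := (strong_prod G H) (at level 40, left associativity).

Section PathGraph.
Variable n : nat.

Definition path_adj : rel 'I_n := fun i j => (i.+1 == j) || (j.+1 == i).

Lemma path_adj_sym : symmetric path_adj.
Proof. by move=> i j; rewrite /path_adj orbC. Qed.

Lemma path_adj_irr : irreflexive path_adj.
Proof. by move=> i; rewrite /path_adj orbb; apply/eqP/eqP; rewrite neq_ltn ltnSn orbT. Qed.

Definition path_graph : sgraph := SGraph path_adj_sym path_adj_irr.

End PathGraph.

(* Main.v *)
Require Import Defs.
From mathcomp Require Import all_boot.
From mathcomp Require Import boolp zify.

(** In the strong product of two paths the distance is the Chebyshev distance.
    Lower bound: two vertices of the main diagonal are joined by a unique
    geodesic, which runs along the diagonal, so an MV set meets the diagonal in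
    at most two vertices.  Upper bound: a single row is an MV set, and so is the
    union of two non-adjacent rows, because a geodesic can leave its end row at
    the first step and stay off both rows until the last one; the residue classes
    of the rows modulo [max 2 (uphalf t)] are of this kind. *)

Set Implicit Arguments.
Unset Strict Implicit.
Unset Printing Implicit Defensive.

(** * Bounds on [chi_mu] and visibility in an arbitrary graph *)

Section ChiMu.
Variable G : sgraph.
Implicit Types (x y z : G) (p q : seq G) (X : {set G}).

Lemma chi_mu_leq_colour k (c : G -> 'I_k) :
  (forall i, mv_set [set x | c x == i]) -> chi_mu G <= k.
Proof.
(* Only attained colours are used, so no block is empty. *)
move=> mvc; pose P := [set [set x | c x == i] | i in c @: [set: G]].
have mvP : mv_partition P.
  split; last by move=> X /imsetP[i _ ->]; apply: mvc.
  apply/and3P; split.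
  - apply/eqP/setP => x; rewrite inE; apply/bigcupP.
    by exists [set y | c y == c x]; rewrite ?inE // !imset_f ?inE.
  - apply/trivIsetP => _ _ /imsetP[i _ ->] /imsetP[j _ ->] nij.
    rewrite -setI_eq0; apply/eqP/setP => x; rewrite !inE.
    by apply/andP => -[/eqP ci /eqP cj]; rewrite -ci -cj eqxx in nij.
  - apply/imsetP => -[i /imsetP[x _ ->] /setP/(_ x)].
    by rewrite !inE eqxx.
rewrite /chi_mu; case: ex_minnP => m _ /(_ #|P|) minm.
apply: leq_trans (minm _) _; first by apply/asboolP; exists P.
rewrite -[leqRHS]card_ord.
exact: leq_trans (leq_imset_card _ _) (max_card _).
Qed.

Lemma chi_mu_geq k :
  (forall P : {set {set G}}, mv_partition P -> k <= #|P|) -> k <= chi_mu G.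
Proof.
move=> kP; rewrite /chi_mu; case: ex_minnP => m /asboolP[P mvP <-] _.
exact: kP.
Qed.

Lemma last_take_internal x p k :
  0 < k < size p -> last x (take k p) \in internal x p.
Proof.
case: p k => [|y p] [|k] //; rewrite /internal /= ltnS.
elim: p y k => [|z p IHp] y [|k] //=; first by rewrite inE eqxx.
by move=> /(IHp z) {}IHp; rewrite inE IHp orbT.
Qed.

(** [p] may repeat vertices. Its loop-erased version uses only vertices of [p], is still no longer
    than any walk from [x] to [y], and, being duplicate-free, meets [x] and [y] only at its ends. *)
Lemma visible_walk X x y p :
  path (@adj G) x p -> last x p = y ->
  (forall q, path (@adj G) x q -> last x q = y -> size p <= size q) ->
  {in p, forall z, z != x -> z != y -> z \notin X} -> visible X x y.
Proof.
move=> xp lastp minp notX; move: lastp.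
case: (shortenP xp) => p' xp' Up' sub_p' lastp'.
exists p'.
  split=> // q [xq lastq _]; apply: leq_trans (minp q xq lastq).
  by apply: uniq_leq_size; [case/andP: Up' | move=> z; apply: sub_p'].
move=> z; case: (lastP p') => [|s y'] in xp' Up' sub_p' lastp' *; first by [].
rewrite /internal belast_rcons /= => zs; rewrite last_rcons in lastp'.
move: Up'; rewrite /= mem_rcons inE negb_or rcons_uniq lastp'.
case/andP=> /andP[_ xs] /andP[ys _]; apply: notX.
- by apply: sub_p'; rewrite mem_rcons inE zs orbT.
- by apply: contraNneq xs => <-.
- by apply: contraNneq ys => <-.
Qed.

Lemma visible_setT_adj x y : x != y -> visible [set: G] x y -> adj x y.
Proof.
move=> nxy [[|z [|w p]]] [[xp lastp _] _] /=.
- by rewrite -lastp eqxx in nxy.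
- by move: xp; rewrite -lastp /= andbT.
- by move/(_ z); rewrite /internal /= !inE eqxx => /(_ isT).
Qed.

Lemma two_leq_chi_mu x y : x != y -> ~~ adj x y -> 2 <= chi_mu G.
Proof.
move=> nxy /negP nadj; apply: chi_mu_geq => P [partP mvP].
rewrite ltnNge; apply/negP => /card_le1_eqP P1; apply: nadj.
have cov z : z \in cover P by rewrite (cover_partition partP) inE.
have XP := pblock_mem (cov x).
have XT : pblock P x = [set: G].
  apply/setP => z; rewrite inE -(P1 _ _ XP (pblock_mem (cov z))).
  by rewrite mem_pblock cov.
apply: (visible_setT_adj nxy); have := mvP _ XP x y; rewrite XT.
by apply; rewrite ?inE.
Qed.

(** Double counting: the fibres of the map sending [i] to the block of [d i] exhaust the [m]
    indices. *)
Lemma leq_mul_card_partition m k (d : 'I_m -> G) (P : {set {set G}}) :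
  partition P [set: G] ->
  (forall X, X \in P -> #|[set i | d i \in X]| <= k) -> m <= #|P| * k.
Proof.
move=> partP dX; suff: \sum_(i < m) 1 <= #|P| * k by rewrite sum1_card card_ord.
have cov z : z \in cover P by rewrite (cover_partition partP) inE.
rewrite (partition_big (fun i => pblock P (d i)) (mem P)) /=; last first.
  by move=> i _; apply: pblock_mem.
rewrite -sum_nat_const; apply: leq_sum => X XP.
rewrite sum1_card; apply: leq_trans (dX X XP); apply/subset_leq_card/subsetP.
move=> i iX; have /eqP <- : pblock P (d i) == X by exact: iX.
by rewrite inE mem_pblock cov.
Qed.

End ChiMu.

(** * Walks in the grid and the lower bound from the diagonal *)

Section Grid.
Variables t r : nat.
Let G := path_graph t ⊠ path_graph r.
Implicit Types (u v z : G) (X : {set G}).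

Lemma grid_adjE u v :
  adj u v = [&& (u.1 != v.1 :> nat) || (u.2 != v.2 :> nat),
                u.1 <= v.1.+1, v.1 <= u.1.+1, u.2 <= v.2.+1 & v.2 <= u.2.+1].
Proof.
case: u v => [u1 u2] [v1 v2]; rewrite /adj /= /strong_adj /= /path_adj.
rewrite xpair_eqE -!val_eqE /=; lia.
Qed.

Lemma grid_eq u v : u.1 = v.1 :> nat -> u.2 = v.2 :> nat -> u = v.
Proof. by case: u v => [u1 u2] [v1 v2] /= /val_inj -> /val_inj ->. Qed.

Lemma grid_neq u v : u != v -> (u.1 != v.1 :> nat) || (u.2 != v.2 :> nat).
Proof.
by apply: contraR; rewrite negb_or !negbK => /andP[/eqP ? /eqP ?]; apply/eqP/grid_eq.
Qed.

(** Each step moves each coordinate by at most one; hence no walk is shorter than the Chebyshev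
    distance of its ends. *)
Lemma grid_walk_leq u p : path (@adj G) u p ->
  [/\ u.1 <= (last u p).1 + size p, (last u p).1 <= u.1 + size p,
      u.2 <= (last u p).2 + size p & (last u p).2 <= u.2 + size p].
Proof.
elim: p u => [|v p IHp] u; first by rewrite !addn0.
case/andP; rewrite grid_adjE => uv /IHp[] + + + +.
rewrite -[last u (v :: p)]/(last v p) -[size (v :: p)]/(size p).+1.
by move: (last v p) => w *; split; lia.
Qed.

Section NatWalk.
Variables (u v : G) (a b : nat -> nat) (d : nat).
Hypotheses (a_lt : forall k, k <= d -> a k < t) (b_lt : forall k, k <= d -> b k < r).
Hypotheses (a0 : a 0 = u.1) (b0 : b 0 = u.2) (ad : a d = v.1) (bd : b d = v.2).
Hypothesis step : forall k, k < d ->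
  [&& (a k != a k.+1) || (b k != b k.+1),
      a k <= (a k.+1).+1, a k.+1 <= (a k).+1,
      b k <= (b k.+1).+1 & b k.+1 <= (b k).+1].

Lemma nat_walk : exists p, [/\ path (@adj G) u p, last u p = v, size p = d &
  {in p, forall z, exists k, [/\ k <= d, z.1 = a k :> nat & z.2 = b k :> nat]}].
Proof.
have vertexP k : k <= d -> exists z : G, z.1 = a k :> nat /\ z.2 = b k :> nat.
  by move=> kd; exists (Ordinal (a_lt kd), Ordinal (b_lt kd)).
suff walk n : n <= d -> exists p, [/\ path (@adj G) u p,
    (last u p).1 = a n :> nat, (last u p).2 = b n :> nat, size p = n &
    {in p, forall z, exists k, [/\ k <= d, z.1 = a k :> nat & z.2 = b k :> nat]}].
  have [p [up pa pb sp pP]] := walk d (leqnn d); exists p; split=> //.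
  by apply: grid_eq; rewrite ?pa ?pb.
elim: n => [_|n IHn nd]; first by exists [::].
have [p [up pa pb sp pP]] := IHn (ltnW nd).
have [w [wa wb]] := vertexP _ nd; exists (rcons p w).
rewrite rcons_path last_rcons size_rcons up sp; split=> //.
  by rewrite grid_adjE pa pb wa wb; apply: step.
move=> z; rewrite mem_rcons inE => /orP[/eqP -> | /pP //].
by exists n.+1.
Qed.

(** Subtraction is truncated, so the disjunction says that [d] is at most the Chebyshev distance of
    [u] and [v], which makes the walk shortest. *)
Lemma visible_nat_walk X :
  [|| d <= u.1 - v.1, d <= v.1 - u.1, d <= u.2 - v.2 | d <= v.2 - u.2] ->
  (forall k z, 0 < k < d -> z.1 = a k :> nat -> z.2 = b k :> nat -> z \notin X) ->
  visible X u v.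
Proof.
move=> d_min notX; have [p [up pv sp pP]] := nat_walk.
apply: (visible_walk up pv).
  by move=> q /grid_walk_leq[] + + + + qv; rewrite qv sp; lia.
move=> z /pP[k [kd za zb]] zu zv; apply: (notX k) => //; apply/andP; split.
  rewrite lt0n; apply: contraNneq zu => k0; apply/eqP.
  by apply: grid_eq; rewrite ?za ?zb k0 ?a0 ?b0.
rewrite ltn_neqAle kd andbT; apply: contraNneq zv => kE; apply/eqP.
by apply: grid_eq; rewrite ?za ?zb kE ?ad ?bd.
Qed.

End NatWalk.

Lemma mv_set_diagonal (d : 'I_(minn t r) -> G) X :
  (forall i, (d i).1 = i :> nat) -> (forall i, (d i).2 = i :> nat) ->
  mv_set X -> #|[set i | d i \in X]| <= 2.
Proof.
move=> d1 d2 mvX; rewrite leqNgt; apply/negP => /card_gt2P.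
case=> i [j] [l] [[]]; rewrite !inE => iX jX lX [nij njl nli].
have between (i' j' l' : 'I_(minn t r)) :
    d i' \in X -> d j' \in X -> d l' \in X -> i' < j' -> j' < l' -> False.
  move=> {i j l nij njl nli iX jX lX}; move=> iX jX lX ij jl.
  have nil : d i' != d l'.
    by apply: contraTneq ij => dil; move: (d1 i'); rewrite dil d1; lia.
  have [p [[ip pl Up] minp] notX] := mvX _ _ iX lX nil.
  (* The geodesic is compared with the straight walk along the diagonal, shortened to a path. *)
  have sp : size p <= l' - i'.
    have lt_l := ltn_ord l'.
    have i't k : k <= l' - i' -> i' + k < t by lia.
    have i'r k : k <= l' - i' -> i' + k < r by lia.
    have i'0 : i' + 0 = i' by lia.
    have i'l' : i' + (l' - i') = l' by lia.
    have [||||k kl|q [iq ql sq _]] := nat_walk (u := d i') (v := d l') i't i'r.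
    + by rewrite d1.
    + by rewrite d2.
    + by rewrite d1.
    + by rewrite d2.
    + lia.
    case/shortenP: iq ql => q' iq' Uq' q'q ql.
    rewrite -sq; apply: leq_trans (minp q' _) _ => //.
    by apply: uniq_leq_size => //; case/andP: Uq'.
  pose k := j' - i'.
  have kp : k < size p.
    by have [] := grid_walk_leq ip; rewrite pl !d1; lia.
  (* The first [k] steps keep both coordinates at most [j'], and the remaining ones, ending at [l'],
     need both to be at least [j']. *)
  have jE : last (d i') (take k p) = d j'.
    move: ip pl; rewrite -{1 2}(cat_take_drop k p) cat_path last_cat.
    case/andP=> /grid_walk_leq[+ + + +] /grid_walk_leq[+ + + +] pl.
    rewrite pl size_drop size_take kp !d1 !d2.
    by rewrite /k; move: (last _ (take _ p)) => w *; apply: grid_eq; rewrite ?d1 ?d2; lia.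
  move: jX; apply/negP; apply: notX; rewrite -jE; apply: last_take_internal.
  by rewrite kp andbT /k; lia.
have := between i j l iX jX lX; have := between i l j iX lX jX.
have := between j i l jX iX lX; have := between j l i jX lX iX.
have := between l i j lX iX jX; have := between l j i lX jX iX.
by move: nij njl nli; rewrite -!val_eqE /=; lia.
Qed.

Lemma uphalf_min_leq_chi_mu : uphalf (minn t r) <= chi_mu G.
Proof.
apply: chi_mu_geq => P [partP mvP].
pose d (i : 'I_(minn t r)) : G :=
  (widen_ord (geq_minl t r) i, widen_ord (geq_minr t r) i).
have := leq_mul_card_partition (k := 2) (d := d) partP.
have dX X : X \in P -> #|[set i | d i \in X]| <= 2.
  by move=> /mvP; apply: mv_set_diagonal.
by move/(_ dX); lia.
Qed.

End Grid.

(** * Residue classes of rows, and walks that avoid them *)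

(** Below [h.*2] the quotient by [h] is 0 or 1, so a colour class consists of at most two rows, [h]
    apart. *)
Lemma mod_eq_lt_double h m n :
  m < h.*2 -> n < h.*2 -> m = n %[mod h] -> [\/ n = m, n = m + h | m = n + h].
Proof.
have modE x : x < h.*2 -> x = x %% h \/ x = x %% h + h.
  move=> xt; have [xh | hx] := ltnP x h; first by rewrite modn_small //; left.
  have xE : x = x - h + h by lia.
  by right; rewrite [in RHS]xE modnDr modn_small //; lia.
move=> /modE mE /modE nE mn_mod; rewrite mn_mod in mE.
move: (n %% h) mE nE => q [] -> [] ->.
- by constructor 1.
- by constructor 2.
- by constructor 3.
- by constructor 1.
Qed.

Lemma modnDl_neq h i s : 0 < s < h -> i + s <> i %[mod h].
Proof.
case/andP=> s0 sh /eqP; rewrite -[X in _ == X %[mod _]]addn0 eqn_modDl.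
by rewrite mod0n modn_small //; case: s s0 {sh}.
Qed.

Lemma toward_walk a b : exists g : nat -> nat,
  [/\ g 0 = a, forall k, (a - b) + (b - a) <= k -> g k = b,
      forall k, g k <= maxn a b,
      forall k, (g k <= (g k.+1).+1) && (g k.+1 <= (g k).+1) &
      forall k, k < (a - b) + (b - a) -> g k != g k.+1].
Proof.
(* This is [minn b (a + k)] if [a <= b] and [maxn b (a - k)] otherwise; it rests at [b] while the
   other coordinate finishes. *)
exists (fun k => maxn (minn b (a + k)) (a - k)).
by split=> [|k|k|k|k]; lia.
Qed.

(* An offset walk from [0] to [e] whose intermediate values are nonzero modulo
   [h]; it may idle only during the first [D] steps, when the other coordinate
   moves. *)
Lemma offset_walk h D e : 2 <= h -> e = h \/ e = 0 /\ 0 < D ->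
  exists s : nat -> nat, exists d : nat,
  [/\ [/\ s 0 = 0, s d = e, D <= d & d = D \/ d = e],
      forall k, s k <= maxn e 1,
      forall k, 0 < k < d -> 0 < s k < h,
      forall k, (s k <= (s k.+1).+1) && (s k.+1 <= (s k).+1) &
      forall k, k < d -> (s k != s k.+1) || (k < D)].
Proof.
move=> h2 [-> | [-> D0]].
  (* Climb to [h.-1], wait there if [D] exceeds [h], and enter [h] only at the last step. *)
  exists (fun k => if k < maxn h D then minn k h.-1 else h), (maxn h D).
  split=> [|k|k /andP[k0 kd]|k|k kd].
  - by rewrite ltnn leq_maxr; case: ifP; split; lia.
  - by case: ifP; lia.
  - by rewrite kd; lia.
  - by do 2?case: ifP; lia.
  - by rewrite kd; case: ifP; lia.
(* Step aside to offset 1 at once and return at the last step. *)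
exists (fun k => (0 < k < D) : nat), D.
split=> [|k|k ->|k|k ->] //; last by rewrite orbT.
- by rewrite /= ltnn andbF; split=> //; left.
- by case: (_ < _ < _).
- by do 2!case: (_ < _ < _).
Qed.

(* [i] and [j] are the end rows (or columns) and [a], [b] the other coordinates
   of the ends; as [i] and [j] differ by [0] or [h], the walk can stay strictly
   between them, or next to them when they coincide. *)
Lemma residue_walk t r h i j a b :
  2 <= h -> 2 <= t -> t <= h.*2 -> i < t -> j < t -> a < r -> b < r ->
  i = j %[mod h] -> (i != j) || (a != b) ->
  exists f g : nat -> nat, exists d : nat,
  [/\ forall k, k <= d -> f k < t,
      forall k, k <= d -> g k < r,
      [/\ f 0 = i, g 0 = a, f d = j & g d = b],
      forall k, k < d ->
        [&& (f k != f k.+1) || (g k != g k.+1),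
            f k <= (f k.+1).+1, f k.+1 <= (f k).+1,
            g k <= (g k.+1).+1 & g k.+1 <= (g k).+1] &
      [|| d <= i - j, d <= j - i, d <= a - b | d <= b - a] /\
      forall k, 0 < k < d -> f k <> i %[mod h]].
Proof.
move=> h2 t2 th it jt ar br ij_mod ij_neq.
have {ij_mod} ij := mod_eq_lt_double (leq_trans it th) (leq_trans jt th) ij_mod.
have [g [g0 gD g_max g_step g_neq]] := toward_walk a b.
have {g_max} g_lt k : g k < r by apply: leq_ltn_trans (g_max k) _; lia.
have : (0 < (a - b) + (b - a)) = (a != b) by lia.
have : (a - b) + (b - a) = a - b \/ (a - b) + (b - a) = b - a by lia.
move: (_ + _) gD g_neq => D gD g_neq D_min D0.
(* [maxn e 1] bounds the offset, so the inequalities keep the walk inside the grid. For [i = j] a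
   neighbouring row exists on some side because [2 <= t]. *)
have [e [eP e_dir]] : exists e, (e = h \/ e = 0 /\ 0 < D) /\
    ((j = i + e /\ i + maxn e 1 < t) \/ (i = j + e /\ maxn e 1 <= i)).
  case: ij => [ji | ji | ji]; [exists 0 | exists h | exists h];
  by (split; [|clear g g0 gD g_lt g_step g_neq D_min D0 ij_neq]); lia.
have [s [d [[s0 sd Dd d_min] s_max s_h s_step s_neq]]] := offset_walk h2 eP.
have d_min' : [|| d <= i - j, d <= j - i, d <= a - b | d <= b - a].
  by clear - D_min e_dir d_min; lia.
case: e_dir => -[ij_e i_e]; [exists (fun k => i + s k) | exists (fun k => i - s k)];
  exists g, d; split=> // [k _ | | k kd | ].
- by apply: leq_ltn_trans i_e; rewrite leq_add2l.
- by rewrite s0 sd addn0 g0 gD // -ij_e.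
- have := s_neq k kd; have := s_step k; have := g_step k; have := g_neq k.
  by clear; lia.
- by split=> // k /s_h; apply: modnDl_neq.
- by apply: leq_ltn_trans it; apply: leq_subr.
- by rewrite s0 sd subn0 g0 gD // [in _ - e]ij_e addnK.
- have := s_neq k kd; have := s_step k; have := g_step k; have := g_neq k.
  have := leq_trans (s_max k) i_e; have := leq_trans (s_max k.+1) i_e.
  by clear; lia.
- split=> // k /s_h sk; rewrite -[X in _ <> X %[mod _]](subnK (leq_trans (s_max k) i_e)).
  by move/esym; apply: modnDl_neq.
Qed.

(** * Colourings, small cases and the final case split *)

Lemma chi_mu_leq_rows t r h :
  2 <= h -> 2 <= t -> t <= h.*2 -> chi_mu (path_graph t ⊠ path_graph r) <= h.
Proof.
move=> h2 t2 th; have h0 : 0 < h by lia.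
pose c (u : path_graph t ⊠ path_graph r) := Ordinal (ltn_pmod u.1 h0).
apply: (@chi_mu_leq_colour _ h c) => i u v.
rewrite !inE -!val_eqE /= => /eqP ui /eqP vi /grid_neq nuv.
have [|f [g [d [fP gP [f0 g0 fd gd] step [d_min fk]]]]] :=
  residue_walk h2 t2 th (ltn_ord u.1) (ltn_ord v.1) (ltn_ord u.2) (ltn_ord v.2) _ nuv.
  by rewrite ui vi.
apply: (visible_nat_walk fP gP f0 g0 fd gd step d_min) => k z kd zf _.
by rewrite inE -val_eqE /= zf -ui; apply/eqP/fk.
Qed.

Lemma chi_mu_leq_columns t r h :
  2 <= h -> 2 <= r -> r <= h.*2 -> chi_mu (path_graph t ⊠ path_graph r) <= h.
Proof.
move=> h2 r2 rh; have h0 : 0 < h by lia.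
pose c (u : path_graph t ⊠ path_graph r) := Ordinal (ltn_pmod u.2 h0).
apply: (@chi_mu_leq_colour _ h c) => i u v.
rewrite !inE -!val_eqE /= => /eqP ui /eqP vi /grid_neq nuv.
rewrite orbC in nuv.
have [|g [f [d [gP fP [g0 f0 gd fd] step [d_min gk]]]]] :=
  residue_walk h2 r2 rh (ltn_ord u.2) (ltn_ord v.2) (ltn_ord u.1) (ltn_ord v.1) _ nuv.
  by rewrite ui vi.
apply: (visible_nat_walk fP gP f0 g0 fd gd).
- by move=> k /step /and5P[n -> -> -> ->]; rewrite orbC n.
- by move: d_min; lia.
by move=> k z kd _ zg; rewrite inE -val_eqE /= zg -ui; apply/eqP/gk.
Qed.

(** The graph is complete, so a single step joins any two vertices. *)
Lemma chi_mu_leq_king22 : chi_mu (path_graph 2 ⊠ path_graph 2) <= 1.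
Proof.
apply: (@chi_mu_leq_colour _ 1 (fun=> ord0)) => i u v _ _ /grid_neq nuv.
have := (ltn_ord u.1, ltn_ord u.2, ltn_ord v.1, ltn_ord v.2) => -[[[u1 u2] v1] v2].
apply: (@visible_nat_walk _ _ u v (fun k => if k == 0 then u.1 : nat else v.1)
  (fun k => if k == 0 then u.2 : nat else v.2) 1) => //; try by case.
- case=> // _; apply/and5P; split=> //; exact: leq_trans _ (ltn0Sn _).
- by move: nuv; lia.
Qed.

(** Opposite corners are not adjacent once a side has three vertices. *)
Lemma two_leq_chi_mu_grid t r :
  2 <= t -> 2 <= r -> 2 < maxn t r -> 2 <= chi_mu (path_graph t ⊠ path_graph r).
Proof.
move=> t2 r2 tr2.
have t0 : 0 < t by lia.
have r0 : 0 < r by lia.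
have t1 : t.-1 < t by lia.
have r1 : r.-1 < r by lia.
apply: (@two_leq_chi_mu (path_graph t ⊠ path_graph r)
  (Ordinal t0, Ordinal r0) (Ordinal t1, Ordinal r1)).
- by rewrite xpair_eqE -!val_eqE /=; lia.
- by rewrite grid_adjE /=; lia.
Qed.

Theorem theorem5p7 (t r : nat) (htr : 2 <= minn t r) :
  chi_mu (path_graph t ⊠ path_graph r) =
    if (t == 2) && (r == 2) then 1
    else if (t != r) && (minn t r == 2) then 2
    else minn (uphalf t) (uphalf r).
Proof.
have lower := @uphalf_min_leq_chi_mu t r.
have [t2 r2] : 2 <= t /\ 2 <= r by lia.
have rows h := @chi_mu_leq_rows t r h ^~ t2.
have columns h := @chi_mu_leq_columns t r h ^~ r2.
have [/andP[/eqP tE /eqP rE] | n22] := ifP.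
  by move: lower; rewrite tE rE => lower; have := chi_mu_leq_king22; lia.
have two := @two_leq_chi_mu_grid t r t2 r2.
(* [h = 2] serves a side of length 2, whose [uphalf] is only 1; longer sides use their own
   [uphalf]. *)
have := rows 2; have := columns 2; have := rows (uphalf t); have := columns (uphalf r).
by case: ifP; lia.
Qed.
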